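(* Let $L$ be an oriented non-split alternating link, let $n_B$ and $n_W$ be the numbers of vertices of its consolidated Tait graphs $G_B^*$ and $G_W^*$, with weighted adjacency matrices $\overline A_B$ and $\overline A_W$, and let $X_B$ and $X_W$ be diagonal matrices of independent commuting vertex variables of sizes $n_B$ and $n_W$. Then, for every $k\ge 3$, $$CWR_k(L)=\left(\frac{1}{2k}\,\operatorname{sq}\Bigl(\operatorname{tr}\bigl((X_B\overline A_B)^k\bigr)\Bigr),\;\frac{1}{2k}\,\operatorname{sq}\Bigl(\operatorname{tr}\bigl((X_W\overline A_W)^k\bigr)\Bigr)\right).$$
   Context: Tait graphs and $CWR$. Let $D$ be a reduced (no nugatory crossings) alternating diagram of an oriented non-split alternating link $L$. The regions of $D$ are checkerboard coloured black and white, so that regions sharing an edge have opposite colours; which class is called black is fixed once and for all by a local rule depending on the over/under pattern at crossings, the same rule for all diagrams (the statement holds for either choice of rule). The Tait graph $G_B$ has one vertex for each black region and one edge for each crossing, joining the black regions meeting at that crossing; $G_W$ is defined in the same way from white regions. Each edge $e$ gets weight $\operatorname{wg}(e)=w$ if the crossing is positive and $r$ if it is negative, where $w,r$ are commuting indeterminates. The consolidated Tait graph $G_B^*$ is the weighted simple graph obtained from $G_B$ by replacing all parallel edges joining the same pair of vertices by a single edge whose weight is the product of their weights; $G_W^*$ is obtained from $G_W$ likewise. For $i>2$, $CB_i(w,r)=\sum_C\prod_{e\in E(C)}\operatorname{wg}(e)$, summed over all unoriented simple cycles $C$ of length $i$ in $G_B^*$; $CB_2(w,r)=\sum_{e\in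 E(G_B^* )}\operatorname{wg}(e)$; $CW_i$ is defined analogously from $G_W^*$; and $CWR_i=(CB_i,CW_i)$ for $i\ge2$. It is a known theorem that $CWR_i$ does not depend on the chosen reduced alternating diagram $D$ of $L$; $CWR_i(L)$ denotes the common value. The weighted adjacency matrix of a simple loopless weighted graph has $(i,j)$ entry equal to the weight of the edge $v_iv_j$ if it exists, and $0$ otherwise. For a polynomial $P=\sum_\alpha c_\alpha x^\alpha$ in the vertex variables with coefficients in $\mathbb{Z}[w,r]$, $\operatorname{sq}(P)=\sum_{\alpha\in\{0,1\}^n}c_\alpha$ is the sum of the coefficients of the squarefree (multilinear) monomials of $P$. *)

(* Defs.v *)
From HB Require Import structures.
From mathcomp Require Import all_boot all_order all_algebra.
From mathcomp Require Import mpoly.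
From Stdlib Require Import Relations ClassicalEpsilon.

Set Implicit Arguments.
Unset Strict Implicit.
Unset Printing Implicit Defensive.

Import GRing.Theory.
Local Open Scope ring_scope.

(* ========================================================================== *)
(** * Oriented link diagrams                                                  *)
(* ========================================================================== *)

(* Diagrams are oriented planar-diagram codes.  The arcs are numbered; a code *)
(* lists the crossings, with the arcs entering and leaving on the under- and  *)
(* on the over-strand, and some 2-valent "joints" (a, b), at which arc a      *)
(* simply continues as arc b.  A joint (a, a) is a component without          *)
(* crossings; the other joints only serve to express Reidemeister moves as    *)
(* replacements of tangles with a fixed boundary.                             *)
Record crossing := Crossing {
  positive : bool;
  under_in : nat; under_out : nat;
  over_in : nat; over_out : nat }.

Definition tuple_of_crossing c :=
  (positive c, under_in c, under_out c, over_in c, over_out c).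
Definition crossing_of_tuple t :=
  let: (s, a, b, c, d) := t in Crossing s a b c d.
Lemma tuple_of_crossingK : cancel tuple_of_crossing crossing_of_tuple.
Proof. by case. Qed.
HB.instance Definition _ :=
  Equality.copy crossing (can_type tuple_of_crossingK).

Definition joint : Type := (nat * nat)%type.

Record code := Code { crossings : seq crossing; joints : seq joint }.

(* (a, true) is the initial end of arc a, i.e. a leaves the vertex there;     *)
(* (a, false) is its final end.                                               *)
Definition dart : Type := (nat * bool)%type.
Definition flip (d : dart) : dart := (d.1, ~~ d.2).

(* The four ends at a crossing, in counterclockwise order.  Positive means    *)
(* that (over direction, under direction) is a positively oriented frame.     *)
Definition crossing_darts (c : crossing) : seq dart :=
  if positive c then
    [:: (under_in c, false); (over_out c, true);
        (under_out c, true); (over_in c, false)]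
  else
    [:: (under_in c, false); (over_in c, false);
        (under_out c, true); (over_out c, true)].
Definition joint_darts (j : joint) : seq dart := [:: (j.1, false); (j.2, true)].

Definition code_vertices (K : code) : seq (seq dart) :=
  map crossing_darts (crossings K) ++ map joint_darts (joints K).
Definition code_darts (K : code) : seq dart := flatten (code_vertices K).

(* Every arc has exactly one initial and one final end. *)
Definition well_formed (K : code) : bool :=
  uniq (code_darts K) && all (fun d => flip d \in code_darts K) (code_darts K).

(* Neighbours of a dart in the cyclic order at its vertex. *)
Definition ccw (K : code) (d : dart) : dart :=
  foldr (fun v d' => if d \in v then next v d else d') d (code_vertices K).
Definition cw (K : code) (d : dart) : dart :=
  foldr (fun v d' => if d \in v then prev v d else d') d (code_vertices K).

Definition dart_of (K : code) : finType := seq_sub (code_darts K).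

(* A region is encoded by the set of darts having it on their left; it is     *)
(* traced by walking to the other end of the arc and taking the leftmost      *)
(* exit.  The corner from d counterclockwise to ccw d lies in region d.       *)
(* For a connected diagram on the sphere these are exactly the regions.       *)
Definition face_next (K : code) (d : dart) : dart := cw K (flip d).
Definition region (K : code) (d : dart) : {set dart_of K} :=
  [set y | val y \in traject (face_next K) d #|dart_of K|].
Definition regions (K : code) : {set {set dart_of K}} :=
  [set region K (val x) | x : dart_of K].

Definition adjacent_darts (K : code) : rel (dart_of K) :=
  fun x y => (val y == flip (val x)) || (val y == ccw K (val x)).
Definition components (K : code) : {set {set dart_of K}} :=
  [set [set y | connect (@adjacent_darts K) x y] | x : dart_of K].
Definition connected (K : code) : bool := #|components K| == 1%N.

(* Euler's formula: every connected component has genus 0. *)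
Definition planar (K : code) : bool :=
  (size (crossings K) + size (joints K) + #|regions K| ==
     #|dart_of K|./2 + #|components K|.*2)%N.

Record diagram := Diagram {
  diagram_code :> code;
  diagramP : well_formed diagram_code && planar diagram_code }.

(* ========================================================================== *)
(** * Links: diagrams up to Reidemeister moves                                *)
(* ========================================================================== *)

Definition relabel_crossing (f : nat -> nat) (c : crossing) : crossing :=
  Crossing (positive c) (f (under_in c)) (f (under_out c))
           (f (over_in c)) (f (over_out c)).
Definition relabel (f : nat -> nat) (K : code) : code :=
  Code (map (relabel_crossing f) (crossings K))
       (map (fun j => (f j.1, f j.2)) (joints K)).

Definition juxtapose (K K' : code) : code :=
  Code (crossings K ++ crossings K') (joints K ++ joints K').

(* One side of a third Reidemeister move.  The top strand runs along the arcs *)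
(* t1 t2 t3, the middle strand along m1 m2 m3, the bottom strand along        *)
(* b1 b2 b3.  The booleans p, q, r tell whether the top (middle, bottom)      *)
(* strand meets the top-middle (top-middle, middle-bottom) crossing before    *)
(* its other crossing; u tells whether the sides of the central triangle      *)
(* appear counterclockwise in the order bottom, middle, top.  These four bits *)
(* determine the signs.                                                       *)
Definition triangle (u p q r : bool)
    (t1 t2 t3 m1 m2 m3 b1 b2 b3 : nat) : code :=
  let fst_half (first : bool) x1 x2 : nat := if first then x1 else x2 in
  Code
    [:: (* middle under top *)
        Crossing (u (+) p (+) q)
          (if q then m1 else m2) (if q then m2 else m3)
          (if p then t1 else t2) (if p then t2 else t3);
        (* bottom under top *)
        Crossing (~~ u (+) p (+) r)
          (if r then b2 else b1) (if r then b3 else b2)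
          (if p then t2 else t1) (if p then t3 else t2);
        (* bottom under middle *)
        Crossing (~~ u (+) q (+) r)
          (if r then b1 else b2) (if r then b2 else b3)
          (if q then m2 else m1) (if q then m3 else m2)]
    [::].

Inductive local_move : code -> code -> Prop :=
| Reidemeister1_under s x m y :
    local_move (Code [:: Crossing s x m m y] [::]) (Code [::] [:: (x, y)])
| Reidemeister1_over s x m y :
    local_move (Code [:: Crossing s m y x m] [::]) (Code [::] [:: (x, y)])
(* The strand a m c passes over the strand b n d, in the parallel and in the  *)
(* antiparallel case.                                                         *)
| Reidemeister2_parallel s a m c b n d :
    local_move (Code [:: Crossing s b n a m; Crossing (~~ s) n d m c] [::])
               (Code [::] [:: (a, c); (b, d)])
| Reidemeister2_antiparallel s a m c b n d :
    local_move (Code [:: Crossing s n d a m; Crossing (~~ s) b n m c] [::])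
               (Code [::] [:: (a, c); (b, d)])
| Reidemeister3 u p q r t1 t2 t3 m1 m2 m3 b1 b2 b3 :
    local_move
      (triangle u p q r t1 t2 t3 m1 m2 m3 b1 b2 b3)
      (triangle u (~~ p) (~~ q) (~~ r) t1 t2 t3 m1 m2 m3 b1 b2 b3).

(* Both sides being well-formed planar codes makes the inner arcs of the      *)
(* tangles fresh and excludes moves that only exist for virtual links.        *)
Inductive move (D D' : diagram) : Prop :=
| move_reorder of perm_eq (crossings D) (crossings D')
                & perm_eq (joints D) (joints D')
| move_relabel f of injective f & diagram_code D' = relabel f D
| move_joint x y xs js of x != y
    & diagram_code D = Code xs ((x, y) :: js)
    & diagram_code D' = relabel (fun z => if z == y then x else z) (Code xs js)
| move_local K K' M of local_move K K'
    & diagram_code D = juxtapose K M & diagram_code D' = juxtapose K' M.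

Definition isotopic : diagram -> diagram -> Prop :=
  clos_refl_sym_trans diagram move.

Record link := Link {
  diagram_of : diagram -> Prop;
  linkP : exists D, forall D', diagram_of D' <-> isotopic D D' }.

(* A link is split iff it has a disconnected diagram. *)
Definition nonsplit (L : link) : Prop :=
  forall D, diagram_of L D -> connected D.

Definition is_over (K : code) (d : dart) : bool :=
  has (fun c => d \in [:: (over_in c, false); (over_out c, true)])
      (crossings K).

(* Every 2-valent vertex is the base point of a circle without crossings. *)
Definition jointless (K : code) : bool := all (fun j => j.1 == j.2) (joints K).

(* Every arc between crossings has exactly one end on an over-strand. *)
Definition alternating (K : code) : bool :=
  jointless K &&
  all (fun c => all (fun d => is_over K d != is_over K (flip d))
                    (crossing_darts c))
      (crossings K).

(* A crossing is nugatory if two opposite corners lie in the same region. *)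
Definition nugatory (K : code) (c : crossing) : bool :=
  let R i := region K (nth (0%N, true) (crossing_darts c) i) in
  (R 0 == R 2)%N || (R 1 == R 3)%N.
Definition reduced (K : code) : bool := ~~ has (nugatory K) (crossings K).

Definition alternating_link (L : link) : Prop :=
  exists2 D, diagram_of L D & alternating D.

(* B is the set of black regions of a checkerboard colouring.  The regions    *)
(* on the two sides of an arc have opposite colours, and the local rule says  *)
(* that the black corners at a crossing are those swept out when the          *)
(* over-strand is rotated counterclockwise (rule = true), respectively        *)
(* clockwise (rule = false), to the under-strand.                             *)
Definition checkerboard (rule : bool) (K : code) (B : {set {set dart_of K}}) :=
  [&& B \subset regions K,
      all (fun d => (region K d \in B) != (region K (flip d) \in B))
          (code_darts K)
    & all (fun c => all (fun d => (region K d \in B) == (is_over K d == rule))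
                        (crossing_darts c))
          (crossings K)].

(* ========================================================================== *)
(** * Weighted graphs                                                         *)
(* ========================================================================== *)

(* The set of end vertices of an edge is a singleton when it is a loop. *)
Record wmultigraph (R : Type) := WMultigraph {
  mvertex : finType;
  medge : finType;
  mends : medge -> {set mvertex};
  mweight : medge -> R }.

Record wgraph (R : Type) := WGraph {
  vertex : finType;
  edges : {set {set vertex}};
  weight : {set vertex} -> R;
  edges_card2 : forall e, e \in edges -> #|e| = 2%N }.

Section Graphs.
Variable R : comNzRingType.

Definition parallel_classes (G : wmultigraph R) : {set {set mvertex G}} :=
  [set e : {set mvertex G} | (#|e| == 2)%N && [exists x, mends x == e]].
Lemma parallel_classes_card2 (G : wmultigraph R) (e : {set mvertex G}) :
  e \in parallel_classes G -> #|e| = 2%N.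
Proof. by rewrite inE => /andP[/eqP]. Qed.

Definition consolidate (G : wmultigraph R) : wgraph R :=
  @WGraph R (mvertex G) (parallel_classes G)
    (fun e => \prod_(x : medge G | mends x == e) mweight x)
    (@parallel_classes_card2 G).

(* The edge set of the closed walk through the vertices of t. *)
Definition cycle_edges (V : finType) (t : seq V) : {set {set V}} :=
  [set [set x; next t x] | x in t].

(* Unoriented simple cycles of length i > 2, identified with their edge sets. *)
Definition simple_cycles (G : wgraph R) (i : nat) : {set {set {set vertex G}}} :=
  [set C : {set {set vertex G}} | (C \subset edges G) &&
     [exists t : i.-tuple (vertex G), uniq t && (C == cycle_edges t)]].

Definition cycle_poly (G : wgraph R) (i : nat) : R :=
  if i == 2%N then \sum_(e in edges G) weight e
  else \sum_(C in simple_cycles G i) \prod_(e in C) weight e.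

Definition nb_vertices (G : wgraph R) : nat := #|vertex G|.

Definition adjacency_mx (G : wgraph R) : 'M[R]_(nb_vertices G) :=
  \matrix_(i, j)
    (let e := [set enum_val i; enum_val j] in
     if e \in edges G then weight e else 0).

Definition variables_mx (n : nat) : 'M[{mpoly R[n]}]_n :=
  diag_mx (\row_(i < n) 'X_i).

(* The adjacency matrix over the polynomial ring in the vertex variables. *)
Definition adjacency_mpoly_mx (G : wgraph R) :
    'M[{mpoly R[nb_vertices G]}]_(nb_vertices G) :=
  map_mx (fun a => a%:MP) (adjacency_mx G).

Definition sq (n : nat) (P : {mpoly R[n]}) : R :=
  \sum_(m <- msupp P | [forall i : 'I_n, (m i <= 1)%N]) P@_m.

End Graphs.

(* ========================================================================== *)
(** * Tait graphs and CWR                                                     *)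
(* ========================================================================== *)

Notation wr_poly := {mpoly int[2]}.
Definition var_w : wr_poly := 'X_ord0.
Definition var_r : wr_poly := 'X_ord_max.

Definition crossing_at (K : code) (i : 'I_(size (crossings K))) : crossing :=
  tnth (in_tuple (crossings K)) i.

(* V is the set of black, or of white, regions. *)
Definition tait_graph (K : code) (V : {set {set dart_of K}}) :
    wmultigraph wr_poly :=
  @WMultigraph wr_poly {x : {set dart_of K} | x \in V}
    'I_(size (crossings K))
    (fun i => [set x | val x \in map (region K) (crossing_darts (crossing_at i))])
    (fun i => if positive (crossing_at i) then var_w else var_r).

Definition tait_black (K : code) (B : {set {set dart_of K}}) : wgraph wr_poly :=
  consolidate (tait_graph B).
Definition tait_white (K : code) (B : {set {set dart_of K}}) : wgraph wr_poly :=
  consolidate (tait_graph (regions K :\: B)).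

Definition CWR_coloured (K : code) (B : {set {set dart_of K}}) (i : nat) :
    wr_poly * wr_poly :=
  (cycle_poly (tait_black B) i, cycle_poly (tait_white B) i).

Definition reduced_alternating_diagram_of (L : link) (D : diagram) : Prop :=
  [/\ diagram_of L D, reduced D & alternating D].

Definition CWR_value (rule : bool) (i : nat) (L : link) (v : wr_poly * wr_poly) :=
  exists D : diagram, exists B : {set {set dart_of D}},
    [/\ reduced_alternating_diagram_of L D, checkerboard rule B
      & v = CWR_coloured B i].

(* CWR_i(L) does not depend on the reduced alternating diagram. *)
Definition CWR_well_defined (rule : bool) (i : nat) (L : link) : Prop :=
  forall v v', CWR_value rule i L v -> CWR_value rule i L v' -> v = v'.

Definition CWR (rule : bool) (i : nat) (L : link) : wr_poly * wr_poly :=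
  epsilon (inhabits (0, 0)) (CWR_value rule i L).

(* The inclusion of Z[w, r] into Q[w, r]. *)
Definition toQ (p : wr_poly) : {mpoly rat[2]} := map_mpoly intr p.

(* Main.v *)
(* Expanding the trace, [tr ((XA)^k)] is the sum over all closed walks of     *)
(* length k of the product of the edge weights times the product of the       *)
(* visited vertex variables.  The squarefree monomials come from the walks    *)
(* without repeated vertices, which for k > 2 trace simple cycles, and each   *)
(* k-cycle is traced by 2k walks: k starting points, two directions.          *)

Require Import Defs.
From mathcomp Require Import all_boot all_order all_algebra.
From mathcomp Require Import ssrcomplements mpoly.
From Stdlib Require Import ClassicalEpsilon.

Set Implicit Arguments.
Unset Strict Implicit.
Unset Printing Implicit Defensive.

Import GRing.Theory.
Local Open Scope ring_scope.

(** Expanding the trace ([mxtrace_pow_closed_walks]) and applying [sq] keeps only the weights of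
    closed walks [t] with [uniq t] ([sq_mxtrace_pow]). Walks through a non-edge contribute 0;
    grouping the others by edge set gives [cycle_poly], provided every fibre has 2k elements. That
    count, [card_tuples_cycle_edges], is the combinatorial core. An edge set determines its vertex
    sequence up to rotation and reversal ([cycle_edges_eqP]), and the 2k resulting sequences differ
    because for k > 2 no vertex is reached again after two steps. The identity is thus proved as a
    multiple by 2k over any commutative coefficient ring; division takes place in Q[w, r]. *)

(** * Successors in a repetition-free cyclic list *)

Section CyclicSequences.
Variable T : eqType.
Implicit Types (x y : T) (s t : seq T).

(* At the last index the default value [x] is the head. *)
Lemma next_nth_head x s i : uniq (x :: s) -> (i < size (x :: s))%N ->
  next (x :: s) (nth x (x :: s) i) = nth x s i.
Proof. by move=> Us lt_i; rewrite next_nth mem_nth // index_uniq. Qed.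

Lemma rot1_map_next s : uniq s -> rot 1 s = map (next s) s.
Proof.
case: s => // x s Us; rewrite rot1_cons.
apply: (@eq_from_nth _ x) => [|i]; rewrite size_rcons ?size_map // => lt_i.
rewrite (nth_map x) // next_nth_head // nth_rcons.
by case: ltngtP => // [gt_i | ->]; rewrite nth_default // ltnW.
Qed.

(** The source of the bound k > 2: it keeps the two directions of a cycle, and the edges of
    consecutive vertices, distinct. *)
Lemma next_next_neq s x :
  uniq s -> (2 < size s)%N -> x \in s -> next s (next s x) != x.
Proof.
move=> Us + xs; have [i s' def_s] := rot_to xs.
rewrite -(next_rot i Us) -[next s x](next_rot i Us) -(size_rot i s).
move: Us; rewrite -(rot_uniq i) def_s; case: s' {def_s} => [|y [|z s']] //=.
rewrite !inE !negb_or eqxx => /and3P[/and3P[xy xz _] _ _] _.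
by move: xy xz; rewrite ![x == _]eq_sym => /negbTE-> zx; rewrite !eqxx.
Qed.

End CyclicSequences.

(** * Cycles as edge sets, and the number of their traversals *)

Section CycleEdges.
Variable V : finType.
Implicit Types (x y : V) (s t : seq V).

Lemma cycle_edgesP t (e : {set V}) :
  reflect (exists2 x, x \in t & e = [set x; next t x]) (e \in cycle_edges t).
Proof. exact: imsetP. Qed.

Lemma mem_cycle_edges s x y : uniq s -> x \in s ->
  ([set x; y] \in cycle_edges s) = (y == next s x) || (y == prev s x).
Proof.
move=> Us xs; apply/idP/orP => [/cycle_edgesP[z zs e_xy]|[]/eqP->].
- have: x \in [set z; next s z] by rewrite -e_xy set21.
  have: y \in [set z; next s z] by rewrite -e_xy set22.
  have: z \in [set x; y] by rewrite e_xy set21.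
  have: next s z \in [set x; y] by rewrite e_xy set22.
  rewrite !in_set2 => nz z_xy y_z /orP[]/eqP x_z.
    (* If [next s z = x = z], the edge is a singleton, which forces [y = z] as well. *)
    left; rewrite x_z; case/orP: nz => [/eqP e|]; last by rewrite eq_sym.
    by move: y_z; rewrite e x_z orbb.
  right; rewrite {1}x_z prev_next //; case/orP: z_xy; last by rewrite eq_sym.
  by move=> /eqP e; move: y_z; rewrite -x_z -e orbb.
- by apply/cycle_edgesP; exists x.
- by apply/cycle_edgesP; exists (prev s x); rewrite ?mem_prev // next_prev // setUC.
Qed.

Lemma cover_cycle_edges s : cover (cycle_edges s) = [set x in s].
Proof.
apply/setP=> x; rewrite inE; apply/bigcupP/idP => [[e /cycle_edgesP[y ys ->]]|xs].
  by rewrite in_set2 => /orP[]/eqP->; rewrite ?mem_next.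
by exists [set x; next s x]; rewrite ?set21 //; apply/cycle_edgesP; exists x.
Qed.

Lemma mem_eq_cycle_edges s t : cycle_edges s = cycle_edges t -> s =i t.
Proof.
move=> est x.
by have /setP/(_ x) := congr1 (@cover V) est; rewrite !cover_cycle_edges !inE.
Qed.

Lemma cycle_edges_rot i s : uniq s -> cycle_edges (rot i s) = cycle_edges s.
Proof.
move=> Us; apply/setP=> e; apply/cycle_edgesP/cycle_edgesP => -[x];
  by rewrite ?mem_rot => xs ->; exists x; rewrite ?mem_rot ?next_rot.
Qed.

Lemma cycle_edges_rev s : uniq s -> cycle_edges (rev s) = cycle_edges s.
Proof.
move=> Us; apply/setP=> e; apply/cycle_edgesP/cycle_edgesP => -[x];
  rewrite ?mem_rev => xs ->.
  by exists (prev s x); rewrite ?mem_prev // next_rev // next_prev // setUC.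
exists (next s x); rewrite ?mem_rev ?mem_next //.
by rewrite next_rev // prev_next // setUC.
Qed.

(* The vertex after [next t x] is its neighbour other than [x]. *)
Lemma eq_next_step s t x : uniq s -> uniq t -> (2 < size t)%N ->
    cycle_edges t = cycle_edges s -> x \in t -> next t x = next s x ->
  next t (next t x) = next s (next s x).
Proof.
move=> Us Ut t_gt2 est xt nx; have xs: x \in s by rewrite -(mem_eq_cycle_edges est).
have: [set next t x; next t (next t x)] \in cycle_edges s.
  by rewrite -est; apply/cycle_edgesP; exists (next t x); rewrite ?mem_next.
rewrite {1}nx mem_cycle_edges ?mem_next // prev_next //.
by rewrite (negbTE (next_next_neq Ut _ _)) // orbF => /eqP.
Qed.

(** Once the start and the first step are fixed, each further step must take the other edge at the
    current vertex. *)
Lemma cycle_edges_inj_head s t x : uniq (x :: s) -> uniq (x :: t) ->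
    (2 < size (x :: t))%N -> cycle_edges (x :: t) = cycle_edges (x :: s) ->
  next (x :: t) x = next (x :: s) x -> t = s.
Proof.
move=> Us Ut t_gt2 est nx; have eq_mem := mem_eq_cycle_edges est.
have sz: size (x :: t) = size (x :: s) by apply/eqP; rewrite -uniq_size_uniq.
(* The induction carries the successor along with the vertex, since the direction of travel is what
   [eq_next_step] propagates. *)
suff next_eq i: (i < size (x :: t))%N ->
    nth x (x :: t) i = nth x (x :: s) i /\
    next (x :: t) (nth x (x :: t) i) = next (x :: s) (nth x (x :: s) i).
  suff [//] : x :: t = x :: s.
  by apply: (@eq_from_nth _ x) => // i /next_eq[].
elim: i => [//|i IHi] lt_i; have [eq_i nx_i] := IHi (ltnW lt_i).
have st: next (x :: t) (nth x (x :: t) i) = nth x (x :: t) i.+1.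
  by rewrite next_nth_head // ltnW.
have ss: next (x :: s) (nth x (x :: s) i) = nth x (x :: s) i.+1.
  by rewrite next_nth_head // -sz ltnW.
rewrite -st -ss; split=> //; rewrite -eq_i.
apply: eq_next_step => //; last by rewrite nx_i eq_i.
by rewrite mem_nth // ltnW.
Qed.

(** The head of [t] has two neighbours in [s]; moving to [next] makes [t] a rotation of [s], and
    moving to [prev] a rotation of [rev s]. *)
Lemma cycle_edges_eqP s t : uniq s -> uniq t -> (2 < size t)%N ->
    cycle_edges t = cycle_edges s ->
  exists2 i, (i < size s)%N & t = rot i s \/ t = rot i (rev s).
Proof.
move=> Us Ut t_gt2 est; case: t => [|x t] // in Ut t_gt2 est *.
have xs: x \in s by rewrite -(mem_eq_cycle_edges est) mem_head.
have rot_head r : uniq r -> x \in r -> cycle_edges (x :: t) = cycle_edges r ->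
    next (x :: t) x = next r x -> exists2 i, (i < size r)%N & x :: t = rot i r.
  move=> Ur xr etr nx; exists (index x r); first by rewrite index_mem.
  have def_r' : rot (index x r) r = x :: behead (rot (index x r) r).
    by rewrite /rot (drop_nth x) ?index_mem //= nth_index.
  rewrite def_r'; congr (_ :: _); apply: (@cycle_edges_inj_head _ _ x) => //.
  - by rewrite -def_r' rot_uniq.
  - by rewrite -def_r' cycle_edges_rot.
  - by rewrite -def_r' next_rot.
have: [set x; next (x :: t) x] \in cycle_edges s.
  by rewrite -est; apply/cycle_edgesP; exists x; rewrite ?mem_head.
rewrite mem_cycle_edges // => /orP[]/eqP nx.
  by have [i lt_i ->] := rot_head s Us xs est nx; exists i; [|left].
have [||||i] := rot_head (rev s); rewrite ?rev_uniq ?mem_rev ?cycle_edges_rev //.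
  by rewrite next_rev.
by rewrite size_rev => lt_i ->; exists i; [|right].
Qed.

Lemma rot_index_inj s i j : uniq s -> (i < size s)%N -> (j < size s)%N ->
  rot i s = rot j s -> i = j.
Proof.
case: s => // x s Us lt_i lt_j /(congr1 (head x)).
rewrite /rot (drop_nth x lt_i) (drop_nth x lt_j) /= => /eqP.
by rewrite (nth_uniq x) // => /eqP.
Qed.

Lemma card_tuples_cycle_edges k (s : k.-tuple V) : (2 < k)%N -> uniq s ->
  #|[set t : k.-tuple V | uniq t && (cycle_edges t == cycle_edges s)]| = (2 * k)%N.
Proof.
move=> k_gt2 Us.
pose f (p : bool * 'I_k) : k.-tuple V :=
  if p.1 then [tuple of rot p.2 s] else [tuple of rot p.2 (rev s)].
have f_inj : injective f.
  (* Rotation preserves [next] and reversal turns it into [prev]; equality would give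
     [next s = prev s], hence a return after two steps. *)
  have rot_rev (i j : 'I_k) : rot i s <> rot j (rev s).
    move=> e; have xs : tnth s i \in s by apply: mem_tnth.
    have := next_rot i Us (tnth s i).
    rewrite e next_rot ?rev_uniq // next_rev // => p_n.
    have := next_next_neq Us; rewrite size_tuple => /(_ _ k_gt2 xs).
    by rewrite -p_n next_prev // eqxx.
  case=> [[] i] [[] j] /(congr1 val) //=.
  - by move/rot_index_inj=> e; congr (_, _); apply/val_inj/e; rewrite ?size_tuple.
  - by move/rot_rev.
  - by move/esym/rot_rev.
  - by move/rot_index_inj=> e; congr (_, _); apply/val_inj/e; rewrite ?size_rev ?rev_uniq ?size_tuple.
transitivity #|[set f p | p : bool * 'I_k]|; last first.
  by rewrite card_imset // card_prod card_bool card_ord.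
apply: eq_card => t; rewrite inE; apply/andP/imsetP => [[Ut /eqP est]|[[b i] _ ->]].
  have [|i] := cycle_edges_eqP Us Ut _ est; rewrite size_tuple // => lt_i.
  by case=> e; [exists (true, Ordinal lt_i)|exists (false, Ordinal lt_i)] => //;
     apply: val_inj.
by case: b; rewrite /f /= rot_uniq ?rev_uniq cycle_edges_rot ?rev_uniq ?cycle_edges_rev.
Qed.

End CycleEdges.

(** * Traces of matrix powers as sums over closed walks *)

Section Trace.
Variables (R : comNzRingType) (n : nat).
Implicit Types (M : 'M[R]_n) (i j : 'I_n).

Lemma big_tuple_cons (T : finType) k (F : seq T -> R) :
  \sum_(t : k.+1.-tuple T) F t = \sum_x \sum_(t : k.-tuple T) F (x :: t).
Proof.
rewrite pair_big /=.
rewrite (reindex (fun p : T * k.-tuple T => [tuple of p.1 :: p.2])) //=.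
exists (fun t : k.+1.-tuple T => (thead t, [tuple of behead t])) => [[x t] _|t _].
  by congr (_, _); apply: val_inj.
by rewrite [RHS]tuple_eta; apply: val_inj.
Qed.

(** Here [t] lists the intermediate vertices, and the [zip] lists the [k.+1] steps from [i] to
    [j]. *)
Lemma mxpowS_walks M k i j : (M ^+ k.+1) i j =
  \sum_(t : k.-tuple 'I_n) \prod_(p <- zip (i :: t) (rcons t j)) M p.1 p.2.
Proof.
elim: k i => [|k IHk] i.
  by rewrite expr1 (big_pred1 [tuple]) ?big_seq1 // => t; apply/esym/eqP/tuple0.
rewrite exprS mxE.
rewrite (big_tuple_cons _ (fun t => \prod_(p <- zip (i :: t) (rcons t j)) M p.1 p.2)).
apply: eq_bigr => l _; rewrite IHk big_distrr; apply: eq_bigr => t _ /=.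
by rewrite big_cons.
Qed.

Lemma mxtrace_pow_closed_walks M k : \tr (M ^+ k.+1) =
  \sum_(t : k.+1.-tuple 'I_n) \prod_(p <- zip t (rot 1 t)) M p.1 p.2.
Proof.
rewrite (big_tuple_cons _ (fun t => \prod_(p <- zip t (rot 1 t)) M p.1 p.2)).
apply: eq_bigr => i _; rewrite mxpowS_walks.
by apply: eq_bigr => t _; rewrite rot1_cons.
Qed.

End Trace.

(** * Extraction of squarefree coefficients *)

Section SquarefreeSum.
Variables (R : comNzRingType) (n : nat).
Implicit Types (P Q : {mpoly R[n]}) (m : 'X_{1..n}).

Let squarefree m := [forall i : 'I_n, (m i <= 1)%N].

(** Replaces the support of [P] by an index set independent of [P], which makes additivity
    visible. *)
Lemma sq_widen d P : (msize P <= d)%N ->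
  sq P = \sum_(m : 'X_{1..n < d} | squarefree m) P@_m.
Proof.
move=> le_Pd; rewrite /sq big_mkcond (big_mksub 'X_{1..n < d}) ?msupp_uniq //=.
  by rewrite big_rmcond /= -?big_mkcond // => m /memN_msupp_eq0 ->; rewrite if_same.
by move=> m /msize_mdeg_lt /leq_trans; apply.
Qed.

Lemma sqD : {morph @sq R n : P Q / P + Q}.
Proof.
move=> P Q; set d := maxn (msize P) (msize Q).
rewrite !(@sq_widen d) ?leq_maxl ?leq_maxr ?(leq_trans (msizeD_le _ _)) //.
by rewrite -big_split; apply: eq_bigr => m _; rewrite mcoeffD.
Qed.

Lemma sq0 : sq (0 : {mpoly R[n]}) = 0.
Proof. by rewrite /sq msupp0 big_nil. Qed.

Lemma sq_sum (I : finType) (F : I -> {mpoly R[n]}) :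
  sq (\sum_i F i) = \sum_i sq (F i).
Proof. exact: (big_morph _ sqD sq0). Qed.

Lemma sq_monomial m (c : R) :
  sq ('X_[m] * c%:MP) = if squarefree m then c else 0.
Proof.
rewrite mulrC mul_mpolyC (@sq_widen (mdeg m).+1); last first.
  by rewrite (leq_trans (msizeZ_le _ _)) // msizeX.
have lt_m : (mdeg m < (mdeg m).+1)%N by [].
case: ifP => sq_m.
  rewrite (bigD1 (BMultinom lt_m)) //= mcoeffZ mcoeffX eqxx mulr1 big1 ?addr0 //.
  move=> m' /andP[_ ne]; rewrite mcoeffZ mcoeffX eq_sym.
  suff /negbTE-> : bmnm m' != m by rewrite mulr0.
  by apply: contraNneq ne => e; apply/eqP/val_inj.
rewrite big1 // => m' sq_m'; rewrite mcoeffZ mcoeffX.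
by case: eqP => [e|_]; [rewrite e sq_m' in sq_m | rewrite mulr0].
Qed.

(** The exponent of ['X_i] in the product is the multiplicity of [i] in [s]. *)
Lemma sq_prod_vars (s : seq 'I_n) (c : R) :
  sq ((\prod_(i <- s) 'X_i) * c%:MP) = if uniq s then c else 0.
Proof.
have -> : \prod_(i <- s) 'X_i = 'X_[(\sum_(i <- s) U_(i))%MM] :> {mpoly R[n]}.
  by rewrite mprodXE.
rewrite sq_monomial; congr (if _ then _ else _).
have count i : (\sum_(j <- s) U_(j))%MM i = count_mem i s.
  rewrite mnm_sumE -sum1_count [RHS]big_mkcond /=.
  by apply: eq_bigr => j _; rewrite mnm1E; case: eqP.
apply/forallP/idP => [le1|/count_uniq_mem Us i].
  by apply: count_mem_uniq => i; have := le1 i; rewrite count;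
     rewrite -has_pred1 has_count; case: (count_mem i s) => [|[]].
by rewrite count Us; case: (_ \in _).
Qed.

Lemma sq_mxtrace_pow (A : 'M[R]_n) k :
  sq (\tr ((variables_mx R n *m map_mx (fun a => a%:MP) A) ^+ k.+1)) =
  \sum_(t : k.+1.-tuple 'I_n | uniq t) \prod_(i <- t) A i (next t i).
Proof.
rewrite mxtrace_pow_closed_walks sq_sum [RHS]big_mkcond; apply: eq_bigr => t _.
(* A step from [i] to [j] contributes ['X_i] times the scalar [A i j], so each walk splits into a
   vertex monomial and a constant. *)
under eq_bigr do rewrite mul_diag_mx !mxE.
rewrite big_split /= -rmorph_prod /=.
rewrite -(big_map fst xpredT (fun i => 'X_i)) -/(unzip1 _) unzip1_zip ?size_rot //.
rewrite sq_prod_vars; case: ifP => // Ut.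
by rewrite rot1_map_next // -[X in zip X _]map_id zip_map big_map.
Qed.

End SquarefreeSum.

(** * From repetition-free closed walks to cycle polynomials and [CWR] *)

Section CyclePolynomial.
Variables (R : comNzRingType) (G : wgraph R).

Lemma prod_cycle_edges (V : finType) (s : seq V) (f : {set V} -> R) :
    uniq s -> (2 < size s)%N ->
  \prod_(e in cycle_edges s) f e = \prod_(x <- s) f [set x; next s x].
Proof.
move=> Us s_gt2; rewrite big_imset /=; first by rewrite -big_uniq.
(* Distinct [x] and [y] giving the same edge would be each other's successors. *)
move=> x y xs ys e; apply/eqP/negPn/negP => xy.
have: y \in [set x; next s x] by rewrite e set21.
have: x \in [set y; next s y] by rewrite -e set21.
rewrite !in_set2 (negbTE xy) [y == x]eq_sym (negbTE xy) /= => /eqP x_ny /eqP y_nx.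
by have := next_next_neq Us s_gt2 xs; rewrite -y_nx -x_ny eqxx.
Qed.

Let adj x y : R :=
  if [set x; y] \in edges G then weight [set x; y] else 0.

Lemma sum_cycles k : (2 < k)%N ->
  \sum_(t : k.-tuple (vertex G) | uniq t) \prod_(x <- t) adj x (next t x) =
  cycle_poly G k *+ (2 * k).
Proof.
move=> k_gt2; rewrite /cycle_poly gtn_eqF // -sumrMnl.
rewrite (bigID (fun t : k.-tuple _ => cycle_edges t \subset edges G)) /=.
rewrite addrC big1 ?add0r => [|t /andP[Ut /subsetPn[e /cycle_edgesP[x xt ->] nE]]];
  last by rewrite (big_rem x) //= /adj (negbTE nE) mul0r.
(* All walks in one fibre have the same weight, and the fibre has [2 * k] elements. *)
rewrite (partition_big (fun t : k.-tuple _ => cycle_edges t)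
  (fun C => C \in simple_cycles G k)) /=; last first.
  move=> t /andP[Ut tE]; rewrite inE tE /=.
  by apply/existsP; exists t; rewrite Ut eqxx.
apply: eq_bigr => C; rewrite inE => /andP[CE /existsP[s /andP[Us /eqP def_C]]].
rewrite -(card_tuples_cycle_edges k_gt2 Us) -sumr_const.
apply: eq_big => [t|t /andP[/andP[Ut tE] /eqP <-]].
  by rewrite inE -def_C; case: eqP => [->|]; rewrite ?CE ?andbT ?andbF.
rewrite prod_cycle_edges ?size_tuple //.
rewrite big_seq [RHS]big_seq; apply: eq_bigr => x xt.
by rewrite /adj (subsetP tE) //; apply/cycle_edgesP; exists x.
Qed.

Lemma sq_mxtrace_cycle_poly k : (2 < k)%N ->
  sq (\tr ((variables_mx R (nb_vertices G) *m adjacency_mpoly_mx G) ^+ k)) =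
  cycle_poly G k *+ (2 * k).
Proof.
move=> k_gt2; rewrite -sum_cycles //; case: k k_gt2 => // k k_gt2.
rewrite sq_mxtrace_pow.
(* Matrix indices are ordinals; [enum_val] transports walks on them to walks on vertices. *)
rewrite [RHS](reindex
    (fun t : k.+1.-tuple 'I_(nb_vertices G) => map_tuple enum_val t)) /=; last first.
  exists (map_tuple enum_rank) => t _; apply: val_inj;
    by rewrite /= -map_comp map_id_in // => x _ /=; rewrite (enum_valK, enum_rankK).
apply: eq_big => [t|t Ut]; first by rewrite map_inj_uniq //; apply: enum_val_inj.
rewrite big_map; apply: eq_bigr => i _.
by rewrite mxE next_map //; apply: enum_val_inj.
Qed.

End CyclePolynomial.

Lemma toQ_cycle_poly (G : wgraph wr_poly) k : (2 < k)%N ->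
  toQ (cycle_poly G k) = (2 * k)%:R^-1 *:
    toQ (sq (\tr ((variables_mx _ (nb_vertices G) *m adjacency_mpoly_mx G) ^+ k))).
Proof.
move=> k_gt2; rewrite sq_mxtrace_cycle_poly // /toQ raddfMn -scaler_nat scalerA.
by rewrite mulVf ?scale1r // Num.Theory.pnatr_eq0 muln_eq0 -lt0n (ltn_trans _ k_gt2).
Qed.

(** As [v] shows that a value exists, [epsilon] chooses a genuine one, which well-definedness
    identifies with [v]. *)
Lemma CWR_eq rule k (L : link) v :
  CWR_well_defined rule k L -> CWR_value rule k L v -> CWR rule k L = v.
Proof.
move=> wd Lv; apply: wd (Lv).
by apply: (epsilon_spec (inhabits (0, 0)) (CWR_value rule k L)); exists v.
Qed.

Theorem corollary3p5 (rule : bool) (L : link) (D : diagram)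
    (B : {set {set dart_of D}}) (k : nat)
    (L_nonsplit : nonsplit L) (L_alternating : alternating_link L)
    (D_L : reduced_alternating_diagram_of L D)
    (B_black : checkerboard rule B) (k_ge3 : (3 <= k)%N) :
  let GB := tait_black B in
  let GW := tait_white B in
  let XAB := variables_mx _ (nb_vertices GB) *m adjacency_mpoly_mx GB in
  let XAW := variables_mx _ (nb_vertices GW) *m adjacency_mpoly_mx GW in
  let rhs := ((2 * k)%:R^-1 *: toQ (sq (\tr (XAB ^+ k))),
              (2 * k)%:R^-1 *: toQ (sq (\tr (XAW ^+ k)))) in
  (toQ (CWR_coloured B k).1, toQ (CWR_coloured B k).2) = rhs
  /\ (CWR_well_defined rule k L ->
      (toQ (CWR rule k L).1, toQ (CWR rule k L).2) = rhs).
Proof.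
move=> GB GW XAB XAW rhs.
have val_B : (toQ (CWR_coloured B k).1, toQ (CWR_coloured B k).2) = rhs.
  by rewrite /= !toQ_cycle_poly.
by split=> // wd; rewrite (@CWR_eq _ _ _ (CWR_coloured B k)) //; exists D, B.
Qed.
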